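(* Equip $\mathbb{Z}^2$ with the lexicographic order and let $A:=\{(x,y)\in\mathbb{Z}^2 : (0,0)<(x,y)\}$. For $n\ge 1$ let $nA:=\sum_{i=1}^{n}A$. Then $nA=\{(x,y)\in\mathbb{Z}^2 : (0,n)\le (x,y)\}$ for every $n\geq 1$; hence $(1,0)\in nA$ for every $n\ge1$, and so $(1,0)\in\bigcap_{n>0}nA$.
   Context: Lexicographic order on $\mathbb{Z}^2$: $(a,b)<(c,d)$ if $a<c$, or $a=c$ and $b<d$. The sum $\sum_{i=1}^nA$ is the set of all sums $a_1+\cdots+a_n$ with $a_i\in A$. *)

(* Defs.v *)
From HB Require Import structures.
From mathcomp Require Import all_boot all_order all_algebra.
From mathcomp Require Import classical_sets.

Set Implicit Arguments.
Unset Strict Implicit.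
Unset Printing Implicit Defensive.

Import Order.TTheory GRing.Theory Num.Theory.

Local Open Scope classical_set_scope.
Local Open Scope ring_scope.

Definition sumset (V : nmodType) (n : nat) (A : set V) : set V :=
  [set x | exists2 a : 'I_n -> V, (forall i, A (a i)) & x = \sum_(i < n) a i].

(* [int * int] carries the componentwise addition; the lexicographic order
   lives on its alias [int *l int], hence the casts. *)
Definition lex_lt (p q : int * int) : bool :=
  ((p : int *l int) < (q : int *l int))%O.

Definition lex_le (p q : int * int) : bool :=
  ((p : int *l int) <= (q : int *l int))%O.

Definition lex_pos : set (int * int) := [set p | lex_lt (0, 0) p].

(* Main.v *)
Require Import Defs.
From mathcomp Require Import all_boot all_order all_algebra.
From mathcomp Require Import classical_sets.
From mathcomp Require Import zify.

Local Open Scope classical_set_scope.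
Local Open Scope ring_scope.

(** The lexicographic order on Z^2 is a translation-invariant discrete order:
    its least positive element is [(0, 1)] ([lex_posE]).  A sum of [n] positive
    elements is therefore at least [n] times [(0, 1)], since inequalities add
    up ([lex_leD], [lex_le_sum]).  Conversely, an element above [(0, n)] is the
    sum of [n - 1] copies of [(0, 1)] and of a remainder that is still at least
    [(0, 1)], hence positive.  As [(1, 0)] exceeds every [(0, n)], it lies in
    every [n]-fold sum: the order is not archimedean. *)

Lemma lex_leE (p q : int * int) :
  lex_le p q = (p.1 <= q.1) && ((q.1 <= p.1) ==> (p.2 <= q.2)).
Proof. by case: p q => [a b] [c d]. Qed.

(** Discreteness: the second coordinate ranges over the integers, where being
    positive is being at least 1. *)
Lemma lex_posE (p : int * int) : lex_pos p <-> lex_le (0, 1) p.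
Proof. by case: p => x y; rewrite lex_leE /lex_pos /lex_lt /=; split. Qed.

Lemma lex_leD (p q p' q' : int * int) :
  lex_le p q -> lex_le p' q' -> lex_le (p + p') (q + q').
Proof. by case: p q p' q' => [? ?] [? ?] [? ?] [? ?]; rewrite !lex_leE /=; lia. Qed.

Lemma lex_le_sum (n : nat) (a : 'I_n -> int * int) :
  (forall i, lex_pos (a i)) -> lex_le (0, n%:Z) (\sum_(i < n) a i).
Proof.
elim: n a => [|n IHn] a a_pos; first by rewrite big_ord0 lex_leE.
rewrite big_ord_recr /=.
have -> : (0, n.+1%:Z) = (0, n%:Z) + (0, 1) :> (int * int).
  by congr pair => /=; lia.
by apply: lex_leD; [exact: IHn | exact/lex_posE/a_pos].
Qed.

Lemma sumset_lex_pos (n : nat) : (1 <= n)%N ->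
  sumset n lex_pos = [set p : int * int | lex_le (0, n%:Z) p].
Proof.
case: n => // n _; apply/seteqP; split => [p [a a_pos ->]|[x y] le_p] /=.
  exact: lex_le_sum.
(* The number of terms is n.+1: the last one absorbs what the n others leave. *)
exists (fun i => if i == ord_max then (x, y - n%:Z) else (0, 1)) => [i|].
  apply/lex_posE; case: eqP => _; last by [].
  by move: le_p; rewrite /= !lex_leE /=; lia.
rewrite big_ord_recr /= eqxx (eq_bigr (fun=> (0, 1))) => [|i _]; last first.
  by rewrite -val_eqE /= ltn_eqF.
have -> : \sum_(i < n) (0, 1) = (0, n%:Z) :> (int * int).
  elim: n {le_p} => [|n IHn]; first by rewrite big_ord0.
  by rewrite big_ord_recr IHn; congr pair => /=; lia.
by congr pair => /=; lia.
Qed.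

Theorem mainTheorem4 :
  [/\ forall n : nat, (1 <= n)%N ->
        sumset n lex_pos = [set p : int * int | lex_le (0, n%:Z) p],
      forall n : nat, (1 <= n)%N -> sumset n lex_pos (1, 0)
    & (\bigcap_(n in [set n : nat | (0 < n)%N]) sumset n lex_pos) (1, 0)].
Proof.
have in10 n : (1 <= n)%N -> sumset n lex_pos (1, 0).
  by move=> n_gt0; rewrite sumset_lex_pos.
by split; [exact: sumset_lex_pos | exact: in10 | move=> n; exact: in10].
Qed.
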